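(* Let $\rho>0$ and $\chi$ be real numbers such that either $\chi\ge 0$, or $\chi<0$ and $\rho/|\chi|$ is a positive integer; assume moreover that $\chi+\rho>0$. Let $(T_n^{\chi,\rho})_{n\ge1}$ be the sequence of linear preferential attachment trees with weights $w_k=\chi k+\rho$, and let $Y_n:=Y(T_n^{\chi,\rho})$, where $Y(T):=\sum_{v\neq w}h(v\wedge w)$. Then $Y_n/n^2\to Q$ almost surely as $n\to\infty$, for some random variable $Q$ with $$\mathbb E\, Q=\frac{\rho}{\chi+\rho}.$$
   Context: **Linear preferential attachment tree.** $T_1^{\chi,\rho}$ is a single root. Given $T_n^{\chi,\rho}$, the tree $T_{n+1}^{\chi,\rho}$ is obtained by adding one new node as a child of an existing node, where the parent is chosen to be $v$ with probability proportional to $w_{d(v)}$; here $d(v)$ is the current outdegree (number of children) of $v$ and $w_k=\chi k+\rho$. (If $\chi<0$ and $\rho=m|\chi|$, then $w_m=0$, so no node ever gets more than $m$ children and $w_k$, $k>m$, are irrelevant.) **The parameter $Y$.** For a rooted tree $T$, $h(v)$ is the depth of node $v$, i.e. its distance to the root, and $v\wedge w$ is the last (deepest) common ancestor of $v$ and $w$ (a node counts as an ancestor of itself here). $Y(T)=\sum_{v\ne w}h(v\wedge w)$, the sum being over all ordered pairs of distinct nodes of $T$. *)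

(* Defs.v *)
From HB Require Import structures.
From mathcomp Require Import all_boot all_order all_algebra.
From mathcomp Require Import all_classical all_reals all_analysis.
Import Order.TTheory GRing.Theory Num.Theory.
Import numFieldNormedType.Exports.

Set Implicit Arguments.
Unset Strict Implicit.
Unset Printing Implicit Defensive.

Local Open Scope classical_set_scope.
Local Open Scope ring_scope.

(* A finite rooted tree with node set V is given by its root and its parent
   map, with the convention that the root is its own parent. *)
Section RootedTree.
Variables (V : finType) (root : V) (parent : V -> V).

(* Distance to the root: position of the root in v, parent v, parent^2 v, ... *)
Definition depth (v : V) : nat := findex parent v root.

(* u is reached from v by iterating the parent map zero or more times. *)
Definition ancestor (u v : V) : bool := fconnect parent v u.

Definition last_common_ancestor (v w : V) : V :=
  [arg max_(u > root | ancestor u v && ancestor u w) depth u]%N.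

(* The root is excluded as a child because it is its own parent. *)
Definition outdegree (v : V) : nat := #|[set u | (u != root) && (parent u == v)]%SET|.

Definition Ypar : nat :=
  (\sum_(v : V) \sum_(w : V | w != v) depth (last_common_ancestor v w))%N.

End RootedTree.

(* A growing tree: nodes are labelled 0, 1, 2, ... in order of arrival, 0 being
   the root. The tree is stored as the sequence of the parents of 1, 2, ..., so
   that the parent of k.+1, entry k of the sequence, is one of 0, ..., k. *)
Definition is_growth (s : seq nat) : bool :=
  all (fun k => nth 0 s k <= k)%N (iota 0 (size s)).

Record growing_tree := GrowingTree {
  parents : seq nat;
  parents_growth : is_growth parents }.

HB.instance Definition _ := [isSub for parents].
HB.instance Definition _ := [Countable of growing_tree by <:].

Definition node (t : growing_tree) := 'I_(size (parents t)).+1.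

Definition tparent (t : growing_tree) (v : node t) : node t :=
  inord (nth 0 (0%N :: parents t) v).

Definition tree_outdegree (t : growing_tree) (v : node t) : nat :=
  outdegree (ord0 : node t) (@tparent t) v.

Definition Y (t : growing_tree) : nat := Ypar (ord0 : node t) (@tparent t).

Definition single_root : growing_tree := @GrowingTree [::] isT.

Lemma is_growth_rcons (t : growing_tree) (v : node t) :
  is_growth (rcons (parents t) v).
Proof.
have hs := allP (parents_growth t).
rewrite /is_growth size_rcons; apply/allP => k; rewrite mem_iota add0n /= ltnS nth_rcons => kle.
case: ltngtP kle => // [klt _ | -> _]; last by rewrite -ltnS ltn_ord.
by apply: hs; rewrite mem_iota.
Qed.

Definition add_child (t : growing_tree) (v : node t) : growing_tree :=
  GrowingTree (is_growth_rcons v).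

Definition weight {R : realType} (chi rho : R) (k : nat) : R :=
  chi * k%:R + rho.

(* The probability of choosing v as the next parent, given the current tree. *)
Definition attachment_prob {R : realType} (chi rho : R) (t : growing_tree)
    (v : node t) : R :=
  weight chi rho (tree_outdegree v) /
  \sum_(u : node t) weight chi rho (tree_outdegree u).

(* (T n)_{n >= 1} is a linear preferential attachment tree process on the
   probability space (Omega, P); T 0 is irrelevant. The conditional law of
   T n.+1 given T n is written in product form; since a growing tree determines
   the trees it grew from, this is also its conditional law given
   T 1, ..., T n. Trees t with a negative weight (possible only if chi < 0)
   are never reached: P [T n = t] = 0. *)
Record pref_attachment {R : realType} {d : measure_display}
    {Omega : measurableType d} (P : probability Omega R) (chi rho : R)
    (T : nat -> Omega -> growing_tree) : Prop := PrefAttachment {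
  pa_measurable : forall n t, (0 < n)%N -> measurable [set x | T n x = t];
  pa_start : P [set x | T 1%N x = single_root] = 1%E;
  pa_step : forall n (t : growing_tree) (v : node t), (0 < n)%N ->
    P ([set x | T n x = t] `&` [set x | T n.+1 x = add_child v]) =
    (P [set x | T n x = t] * (attachment_prob chi rho v)%:E)%E }.

(* Main.v *)
(* Normalise the weights by chi + rho, so that a := chi / (chi + rho) and
   1 - a = rho / (chi + rho) replace chi and rho. Since h(v ^ w) drops by one when v
   is replaced by its parent exactly if v is an ancestor of w, the mean one-step
   increments of Y and of the path length Z are affine in (Y, Z), and
     M_n = (Y_n + 2(1-a) Z_n + 2(1-a)^2 n - (1-a)^2 a) / ((n-a)(n+1-a))
   is a martingale, with M_1 = 1 - a. Its increments are O((h+1)/n), where h is the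
   depth of the new parent, and the mean of sum_v x^h(v) grows like n^(3/2) for a
   suitable x > 1, so E (M_(n+1) - M_n)^2 = O(n^(-3/2)). Hence the increments of M
   along n = k^6 are summable in L^1: M converges almost surely and in mean along
   this subsequence, Z_n / n^2 vanishes along it, and as Y is nondecreasing and
   (k+1)^6 / k^6 -> 1 the convergence of Y_n / n^2 extends to all n. *)
Require Import Defs.
From HB Require Import structures.
From mathcomp Require Import all_boot all_order all_algebra.
From mathcomp Require Import all_classical all_reals all_analysis.
From mathcomp Require Import measurable_realfun.
From mathcomp Require Import zify ring lra.
Import Order.TTheory GRing.Theory Num.Theory.
Import numFieldNormedType.Exports.

Set Implicit Arguments.
Unset Strict Implicit.
Unset Printing Implicit Defensive.

Local Open Scope classical_set_scope.
Local Open Scope ring_scope.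

(** * Rooted trees *)

Definition common_depth {V : finType} (root : V) (parent : V -> V) (v w : V) : nat :=
  depth root parent (last_common_ancestor root parent v w).

Section RootedTreeTheory.
Context {V : finType} (root : V) (parent : V -> V).
Hypothesis parent_root : parent root = root.
Hypothesis root_ancestor : forall v, ancestor parent root v.

Local Notation depth := (depth root parent).
Local Notation ancestor := (ancestor parent).
Local Notation lca_depth := (common_depth root parent).

Lemma ancestorP (u v : V) :
  reflect (exists k, iter k parent v = u) (ancestor u v).
Proof.
apply: (iffP idP) => [/iter_findex <-|[k <-]]; last exact: fconnect_iter.
by eexists.
Qed.

Lemma ancestor_refl (v : V) : ancestor v v.
Proof. exact: connect0. Qed.

Lemma ancestor_trans (u v w : V) : ancestor u v -> ancestor v w -> ancestor u w.
Proof. by move=> uv vw; apply: connect_trans uv. Qed.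

Lemma ancestor_parent (v : V) : ancestor (parent v) v.
Proof. exact: fconnect1. Qed.

Lemma ancestorE (u v : V) :
  ancestor u v = (u == v) || ancestor u (parent v).
Proof.
apply/idP/idP => [/ancestorP[[/= -> |k <-]]|/orP[/eqP->|uv]].
- by rewrite eqxx.
- by apply/orP; right; rewrite iterSr; apply: fconnect_iter.
- exact: ancestor_refl.
- exact: ancestor_trans uv (ancestor_parent v).
Qed.

Lemma ancestor_of_root (u : V) : ancestor u root = (u == root).
Proof.
apply/idP/eqP => [/ancestorP[k <-]|->]; last exact: ancestor_refl.
by elim: k => //= k ->.
Qed.

(** [findex] returns the first position of the root on the orbit of [v], so any number of parent
    steps ending at the root bounds it. *)
Lemma depth_le (v : V) (k : nat) : iter k parent v = root -> (depth v <= k)%N.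
Proof.
move=> vk; rewrite leqNgt; apply/negP => lt_k.
have := findex_iter (ltn_trans lt_k (findex_max (root_ancestor v))).
by rewrite vk => E; move: lt_k; rewrite /Defs.depth E ltnn.
Qed.

Lemma iter_depth (v : V) : iter (depth v) parent v = root.
Proof. exact: iter_findex (root_ancestor v). Qed.

Lemma depth_root : depth root = 0%N.
Proof. exact: findex0. Qed.

Lemma depth_eq0 (v : V) : (depth v == 0%N) = (v == root).
Proof. exact: findex_eq0. Qed.

Lemma depth_parent (v : V) : v != root -> depth v = (depth (parent v)).+1.
Proof.
move=> v_root; apply/eqP; rewrite eqn_leq; apply/andP; split.
  by apply: depth_le; rewrite iterSr iter_depth.
move: v_root (iter_depth v); rewrite -depth_eq0.
by case: (depth v) => // k _; rewrite iterSr => /depth_le; rewrite ltnS.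
Qed.

Lemma parent_ind (Q : V -> Prop) :
  Q root -> (forall v, v != root -> Q (parent v) -> Q v) -> forall v, Q v.
Proof.
move=> Qroot Qparent v; have [k] := ubnP (depth v); elim: k v => // k IH v vk.
have [->//|v_root] := eqVneq v root; apply: Qparent => //; apply: IH.
by rewrite depth_parent// in vk.
Qed.

Lemma ancestor_depth (u v : V) : ancestor u v -> (depth u <= depth v)%N.
Proof.
elim/parent_ind: v => [|v v_root IH]; first by rewrite ancestor_of_root => /eqP->.
rewrite ancestorE => /orP[/eqP->//|/IH le_uv].
by rewrite (depth_parent v_root) (leq_trans le_uv).
Qed.

(** Lets later proofs compare sets of common ancestors without identifying the node picked by the
    arg max, whose default [root] is itself a common ancestor. *)
Lemma lca_depth_leP (k : nat) (v w : V) :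
  reflect (forall u, ancestor u v -> ancestor u w -> (depth u <= k)%N)
          (lca_depth v w <= k)%N.
Proof.
rewrite /common_depth /last_common_ancestor; case: arg_maxnP => [|u /andP[uv uw] max_u].
  by rewrite !root_ancestor.
apply: (iffP idP) => [le_k x xv xw|]; last exact.
by apply: leq_trans le_k; apply: max_u; rewrite xv.
Qed.

Lemma lca_depth_ge (u v w : V) :
  ancestor u v -> ancestor u w -> (depth u <= lca_depth v w)%N.
Proof. by apply/lca_depth_leP. Qed.

Lemma eq_lca_depth (v v' w w' : V) :
  (forall u, (ancestor u v && ancestor u w) = (ancestor u v' && ancestor u w')) ->
  lca_depth v w = lca_depth v' w'.
Proof.
move=> E; apply/eqP; rewrite eqn_leq; apply/andP.
by split; apply/lca_depth_leP => u uv uw; have := E u; rewrite uv uw ?andbT;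
  [move=> /esym|]; move=> /andP[]; apply: lca_depth_ge.
Qed.

Lemma lca_depthC (v w : V) : lca_depth v w = lca_depth w v.
Proof. by apply: eq_lca_depth => u; rewrite andbC. Qed.

Lemma lca_depth_lel (v w : V) : (lca_depth v w <= depth v)%N.
Proof. by apply/lca_depth_leP => u /ancestor_depth. Qed.

Lemma lca_depth_ancestor (v w : V) : ancestor v w -> lca_depth v w = depth v.
Proof.
move=> vw; apply/eqP; rewrite eqn_leq lca_depth_lel/=.
by apply: lca_depth_ge vw; apply: ancestor_refl.
Qed.

(** Passing to the parent removes only [v] from the ancestors of [v]. This costs one level if [v]
    was the last common ancestor, and nothing if [v] was not common. *)
Lemma lca_depth_parent (v w : V) : v != root ->
  lca_depth v w = (lca_depth (parent v) w + ancestor v w)%N.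
Proof.
move=> v_root; case: (boolP (ancestor v w)) => [vw|nvw].
  rewrite (lca_depth_ancestor vw) (depth_parent v_root) addn1.
  by rewrite (lca_depth_ancestor (ancestor_trans (ancestor_parent v) vw)).
rewrite addn0; apply: eq_lca_depth => u; rewrite (ancestorE u v).
by case: eqP => //= ->; rewrite (negPf nvw) andbF.
Qed.

(** Each parent step towards the root leaves exactly one non-root ancestor behind. *)
Lemma depth_sum_ancestors (w : V) :
  depth w = (\sum_(u | u != root) ancestor u w)%N.
Proof.
elim/parent_ind: w => [|w w_root IH].
  by rewrite depth_root big1// => u /negPf; rewrite ancestor_of_root => ->.
rewrite depth_parent// IH [RHS](bigD1 w)//= ancestor_refl add1n; congr S.
(* [w] is not an ancestor of its own parent, whose depth is smaller. *)
rewrite [in LHS](bigD1 w)//=; case: (boolP (ancestor w _)) => [/ancestor_depth|_].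
  by rewrite (depth_parent w_root) ltnn.
by apply: eq_bigr => u /andP[_ /negPf u_w]; rewrite [in RHS]ancestorE u_w.
Qed.

(** Grouping the non-root nodes by their parent. This is where linearity of the weights in the
    outdegree will pay off. *)
Lemma sum_outdegree {M : nmodType} (F : V -> M) :
  \sum_v F v *+ outdegree root parent v = \sum_(u | u != root) F (parent u).
Proof.
rewrite [RHS](partition_big parent predT)//=; apply: eq_bigr => v _.
rewrite -sumr_const; apply: eq_big => [u|u]; first by rewrite inE.
by rewrite inE => /andP[_ /eqP->].
Qed.

(** The diagonal terms h(v ^ v) = h(v) complete the sum over distinct pairs. *)
Lemma Ypar_lca :
  (Ypar root parent + \sum_v depth v)%N = (\sum_v \sum_w lca_depth v w)%N.
Proof.
rewrite -big_split/=; apply: eq_bigr => v _; rewrite [in RHS](bigD1 v)//=.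
by rewrite addnC lca_depth_ancestor ?ancestor_refl.
Qed.

End RootedTreeTheory.

(** * Attaching a leaf *)

Section LeafExtension.
Context {V V' : finType} (root : V) (parent : V -> V) (root' : V') (parent' : V' -> V').
Context (old : V -> V') (leaf : V') (p : V).
Hypothesis parent_root : parent root = root.
Hypothesis root_ancestor : forall v, ancestor parent root v.
Hypothesis old_inj : injective old.
Hypothesis old_leaf : forall v, old v != leaf.
Hypothesis old_or_leaf : forall v', v' = leaf \/ exists v, v' = old v.
Hypothesis old_root : old root = root'.
Hypothesis parent_old : forall v, parent' (old v) = old (parent v).
Hypothesis parent_leaf : parent' leaf = old p.

Local Notation lca_depth := (common_depth root parent).
Local Notation lca_depth' := (common_depth root' parent').

Lemma ancestor_old (u v : V) : ancestor parent' (old u) (old v) = ancestor parent u v.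
Proof.
have old_eq x y : (old x == old y) = (x == y) by exact: inj_eq.
elim/(parent_ind root_ancestor): v => [|v _ IH].
  by rewrite old_root !ancestor_of_root -?old_root ?parent_old ?parent_root.
by rewrite ancestorE parent_old IH old_eq -ancestorE.
Qed.

Lemma root_ancestor_leaf (v' : V') : ancestor parent' root' v'.
Proof.
have root_old v : ancestor parent' root' (old v) by rewrite -old_root ancestor_old.
case: (old_or_leaf v') => [->|[v ->//]].
by rewrite ancestorE parent_leaf root_old orbT.
Qed.

Lemma parent_root_leaf : parent' root' = root'.
Proof. by rewrite -old_root parent_old parent_root. Qed.

Lemma leaf_not_ancestor (v : V) : ancestor parent' leaf (old v) = false.
Proof.
elim/(parent_ind root_ancestor): v => [|v _ IH].
  rewrite old_root ancestor_of_root -?old_root ?parent_old ?parent_root//.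
  by rewrite eq_sym; apply/negbTE/old_leaf.
by rewrite ancestorE parent_old IH orbF eq_sym; apply/negbTE/old_leaf.
Qed.

Lemma depth_old (v : V) : depth root' parent' (old v) = depth root parent v.
Proof.
elim/(parent_ind root_ancestor): v => [|v v_root IH].
  by rewrite old_root !depth_root.
rewrite (depth_parent root_ancestor_leaf) ?parent_old ?IH -?depth_parent//.
by rewrite -old_root (inj_eq old_inj).
Qed.

Lemma depth_leaf : depth root' parent' leaf = (depth root parent p).+1.
Proof.
rewrite (depth_parent root_ancestor_leaf) ?parent_leaf ?depth_old//.
by rewrite eq_sym -old_root.
Qed.

(** The new leaf is an ancestor of no old node, so common ancestors of old nodes stay the same. *)
Lemma lca_depth_old (v w : V) : lca_depth' (old v) (old w) = lca_depth v w.
Proof.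
apply/eqP; rewrite eqn_leq; apply/andP; split.
  apply/(lca_depth_leP root_ancestor_leaf) => u'.
  case: (old_or_leaf u') => [->|[u ->]]; first by rewrite leaf_not_ancestor.
  by rewrite !ancestor_old depth_old; apply: lca_depth_ge.
apply/(lca_depth_leP root_ancestor) => u; rewrite -!ancestor_old -depth_old.
exact: (lca_depth_ge root_ancestor_leaf).
Qed.

(** Apart from itself, the leaf has the ancestors of [p], and it is not an ancestor of [old w]. *)
Lemma lca_depth_leaf (w : V) : lca_depth' leaf (old w) = lca_depth p w.
Proof.
rewrite -lca_depth_old; apply: (eq_lca_depth root_ancestor_leaf) => u'.
rewrite (ancestorE _ u' leaf) parent_leaf.
by case: eqP => [->|]//=; rewrite leaf_not_ancestor !andbF.
Qed.

Lemma big_leaf {M : Type} {idx : M} (op : Monoid.com_law idx) (F : V' -> M) :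
  \big[op/idx]_v' F v' = op (F leaf) (\big[op/idx]_v F (old v)).
Proof.
rewrite (bigD1 leaf)//=; congr (op _ _).
rewrite -(big_map old predT F).
rewrite -big_filter; apply: perm_big; apply: uniq_perm.
- by rewrite filter_uniq// index_enum_uniq.
- by rewrite map_inj_uniq// index_enum_uniq.
move=> v'; rewrite mem_filter mem_index_enum andbT.
case: (old_or_leaf v') => [->|[v ->]].
  rewrite eqxx; apply/esym/negbTE/negP => /mapP[v _ /eqP].
  by rewrite eq_sym (negPf (old_leaf v)).
by rewrite old_leaf map_f// mem_index_enum.
Qed.

(** The new ordered pairs are (leaf, w) and (w, leaf) with [w] old, each contributing h(p ^ w). The
    diagonal term of the leaf cancels against its depth. *)
Lemma Ypar_leaf :
  (Ypar root' parent' = Ypar root parent + 2 * \sum_w lca_depth p w)%N.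
Proof.
have := Ypar_lca parent_root_leaf root_ancestor_leaf.
rewrite !big_leaf/= (eq_bigr _ (fun v _ => depth_old v)).
have -> : \sum_v \sum_w lca_depth' (old v) w =
    (\sum_v (lca_depth p v + \sum_w lca_depth v w))%N.
  apply: eq_bigr => v _; rewrite big_leaf/=; congr (_ + _)%N.
    by rewrite -lca_depth_leaf lca_depthC//; exact: root_ancestor_leaf.
  by apply: eq_bigr => w _; apply: lca_depth_old.
rewrite (eq_bigr _ (fun w _ => lca_depth_leaf w)) big_split/=.
rewrite -(Ypar_lca parent_root root_ancestor).
rewrite (lca_depth_ancestor parent_root_leaf root_ancestor_leaf (ancestor_refl _ _)).
lia.
Qed.

End LeafExtension.

(** * Growing trees *)

Section GrowingTree.
Implicit Types (t : growing_tree).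

Definition node_count t : nat := (size (parents t)).+1.

Definition tree_depth t (v : node t) : nat := depth (ord0 : node t) (@tparent t) v.

Definition tree_lca_depth t (v w : node t) : nat :=
  common_depth (ord0 : node t) (@tparent t) v w.

Definition path_length t : nat := (\sum_(v : node t) tree_depth v)%N.

Definition depth_gf {R : pzSemiRingType} (x : R) t : R :=
  \sum_(v : node t) x ^+ tree_depth v.

Lemma tparent0 t : @tparent t ord0 = ord0.
Proof. by apply: ord_inj; rewrite /tparent inordK. Qed.

(** Entries of a growth sequence stay below the number of nodes, so [inord] never falls back to its
    default. *)
Lemma val_tparent t (v : node t) : tparent v = nth 0 (0%N :: parents t) v :> nat.
Proof.
rewrite /tparent inordK//; case: v => [[|k] /= kt]; first by [].
apply: leq_ltn_trans (_ : (k < _)%N); last exact: ltnW.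
rewrite ltnS in kt; apply: (allP (parents_growth t)).
by rewrite mem_iota.
Qed.

Lemma tparent_lt t (v : node t) : v != ord0 -> (tparent v < v)%N.
Proof.
rewrite -val_eqE/= val_tparent.
case: v => [[|k] /= kt] // _; rewrite ltnS.
by apply: (allP (parents_growth t)); rewrite mem_iota.
Qed.

Lemma ord0_ancestor t (v : node t) : ancestor (@tparent t) ord0 v.
Proof.
have [k] := ubnP (v : nat); elim: k v => // k IH v vk.
have [->|v0] := eqVneq v ord0; first exact: ancestor_refl.
rewrite ancestorE IH ?orbT//.
by apply: leq_trans (tparent_lt v0) _; rewrite -ltnS.
Qed.

Lemma node_count_add_child t (p : node t) :
  node_count (add_child p) = (node_count t).+1.
Proof. by rewrite /node_count size_rcons. Qed.

Section AddChild.
Context {t : growing_tree} (p : node t).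

(** An old node keeps its label; only its ordinal type grows. *)
Let old (v : node t) : node (add_child p) := inord v.
Let leaf : node (add_child p) := ord_max.

Let val_old (v : node t) : old v = v :> nat.
Proof. by rewrite inordK// size_rcons ltnS ltnW. Qed.

Let val_leaf : leaf = node_count t :> nat.
Proof. by rewrite /= size_rcons. Qed.

Let old_inj : injective old.
Proof. by move=> v w /(congr1 (@nat_of_ord _)); rewrite !val_old => /ord_inj. Qed.

Let old_leaf (v : node t) : old v != leaf.
Proof.
apply/eqP => /(congr1 (@nat_of_ord _)); rewrite val_old val_leaf => E.
by have := ltn_ord v; rewrite E ltnn.
Qed.

Let old_or_leaf (v' : node (add_child p)) : v' = leaf \/ exists v, v' = old v.
Proof.
have [lt_v|ge_v] := ltnP v' (node_count t).
  by right; exists (Ordinal lt_v); apply: ord_inj; rewrite val_old.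
left; apply: ord_inj; rewrite val_leaf; apply/eqP; rewrite eqn_leq ge_v andbT.
by rewrite -ltnS -(node_count_add_child p) ltn_ord.
Qed.

Let old_root : old ord0 = ord0.
Proof. by apply: ord_inj; rewrite val_old. Qed.

Let parent_old (v : node t) : tparent (old v) = old (tparent v).
Proof.
apply: ord_inj; rewrite val_old !val_tparent val_old /=.
by rewrite -rcons_cons nth_rcons /= ltn_ord.
Qed.

Let parent_leaf : tparent leaf = old p.
Proof.
apply: ord_inj; rewrite val_old val_tparent val_leaf.
by rewrite /= nth_rcons ltnn eqxx.
Qed.

Lemma Y_add_child :
  Y (add_child p) = (Y t + 2 * \sum_(w : node t) tree_lca_depth p w)%N.
Proof.
exact: (Ypar_leaf (tparent0 t) (@ord0_ancestor t) old_inj old_leaf old_or_leaf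
  old_root parent_old parent_leaf).
Qed.

Let tree_depth_old (v : node t) : tree_depth (old v) = tree_depth v.
Proof.
exact: (depth_old (tparent0 t) (@ord0_ancestor t) old_inj old_or_leaf old_root
  parent_old parent_leaf).
Qed.

Let tree_depth_leaf : tree_depth leaf = (tree_depth p).+1.
Proof.
exact: (depth_leaf (tparent0 t) (@ord0_ancestor t) old_inj old_leaf old_or_leaf old_root
  parent_old parent_leaf).
Qed.

Lemma path_length_add_child :
  path_length (add_child p) = (path_length t + (tree_depth p).+1)%N.
Proof.
rewrite /path_length (big_leaf old_inj old_leaf old_or_leaf)/= tree_depth_leaf.
by rewrite addnC; congr (_ + _)%N; apply: eq_bigr => v _; apply: tree_depth_old.
Qed.

Lemma depth_gf_add_child (R : pzSemiRingType) (x : R) :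
  depth_gf x (add_child p) = depth_gf x t + x ^+ (tree_depth p).+1.
Proof.
rewrite /depth_gf (big_leaf old_inj old_leaf old_or_leaf)/= tree_depth_leaf.
by rewrite addrC; congr (_ + _); apply: eq_bigr => v _; rewrite tree_depth_old.
Qed.

End AddChild.

Lemma Y_single_root : Y single_root = 0%N.
Proof. by rewrite /Y /Ypar big1// => v _; rewrite big1// => w; rewrite !ord1. Qed.

Lemma path_length_single_root : path_length single_root = 0%N.
Proof. by rewrite /path_length big_ord1; apply: depth_root. Qed.

End GrowingTree.

(** * One attachment step *)

(** The conditional mean of F(parent of the next node), given that the current tree is [t]. *)
Definition attachment_mean {R : realType} (chi rho : R) (t : growing_tree)
    (F : node t -> R) : R :=
  \sum_(v : node t) attachment_prob chi rho v * F v.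

Section AttachmentMean.
Context {R : realType} (a : R).
Hypothesis a_lt1 : a < 1.
Implicit Types t : growing_tree.

Local Notation rho := (1 - a).
Local Notation n_ t := ((node_count t)%:R : R).
Local Notation mean := (attachment_mean a rho).

(** Permits normalising the weights to chi + rho = 1, as a common factor cancels in the quotient. *)
Lemma attachment_prob_scale (c chi r : R) t (v : node t) : c != 0 ->
  attachment_prob (c * chi) (c * r) v = attachment_prob chi r v.
Proof.
move=> c0; rewrite /attachment_prob.
have E k : weight (c * chi) (c * r) k = c * weight chi r k.
  by rewrite /weight mulrDr mulrA.
under eq_bigr do rewrite E.
by rewrite E -mulr_sumr invfM mulrACA divff// mul1r. 
Qed.

Lemma sum_weight chi r t (F : node t -> R) :
  \sum_v weight chi r (tree_outdegree v) * F v =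
  r * \sum_v F v + chi * \sum_(u | u != ord0) F (tparent u).
Proof.
rewrite -(sum_outdegree (ord0 : node t) (@tparent t)) !mulr_sumr -big_split/=.
by apply: eq_bigr => v _; rewrite /weight /tree_outdegree -mulr_natl; ring.
Qed.

Lemma sum_nonroot t (F : node t -> R) :
  \sum_(u | u != ord0) F u = \sum_u F u - F ord0.
Proof. by rewrite [in RHS](bigD1 ord0)//= addrAC subrr add0r. Qed.

Lemma node_count_gt0 t : 0 < n_ t - a.
Proof. by rewrite subr_gt0 (lt_le_trans a_lt1)// ler1n. Qed.

(** The constant part of the weight picks a uniform node, the linear part the parent of a uniform
    non-root node; this turns all means into sums over nodes. *)
Lemma attachment_meanE t (F : node t -> R) :
  mean F = (rho * \sum_v F v + a * \sum_(u | u != ord0) F (tparent u)) / (n_ t - a).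
Proof.
(* The total weight is (1 - a) n + a (n - 1) = n - a, obtained from the case F = 1. *)
have <- : \sum_(u : node t) weight a rho (tree_outdegree u) = n_ t - a.
  transitivity (\sum_(u : node t) weight a rho (tree_outdegree u) * 1).
    by under [RHS]eq_bigr do rewrite mulr1.
  rewrite sum_weight sum_nonroot !sumr_const !card_ord -/(node_count t).
  ring.
rewrite -sum_weight mulr_suml; apply: eq_bigr => v _.
by rewrite /attachment_prob mulrAC.
Qed.

Lemma attachment_mean_cst t (c : R) : mean (fun _ : node t => c) = c.
Proof.
rewrite attachment_meanE sum_nonroot !sumr_const !card_ord -/(node_count t).
rewrite -(mulr_natr c).
have := node_count_gt0 t; move: (n_ t) => n n0.
by field; rewrite gt_eqF.
Qed.

Lemma attachment_meanD t (F G : node t -> R) :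
  mean (fun v => F v + G v) = mean F + mean G.
Proof. by rewrite -big_split/=; apply: eq_bigr => v _; rewrite mulrDr. Qed.

Lemma attachment_meanZ t (c : R) (F : node t -> R) :
  mean (fun v => c * F v) = c * mean F.
Proof. by rewrite mulr_sumr; apply: eq_bigr => v _; rewrite mulrCA. Qed.

Lemma attachment_meanS t (F G : node t -> R) :
  (forall v : node t, 0 <= attachment_prob a rho v) ->
  (forall v, F v <= G v) -> mean F <= mean G.
Proof. by move=> a0 FG; apply: ler_sum => v _; apply: ler_wpM2l. Qed.

Lemma sum_lca_depth t :
  (\sum_(v : node t) \sum_(w : node t) tree_lca_depth v w = Y t + path_length t)%N.
Proof. by rewrite -(Ypar_lca (tparent0 t) (@ord0_ancestor t)). Qed.

Lemma attachment_mean_lca t :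
  mean (fun v : node t => (\sum_(w : node t) tree_lca_depth v w)%:R) =
  ((Y t)%:R + rho * (path_length t)%:R) / (n_ t - a).
Proof.
have C0 (w : node t) : tree_lca_depth ord0 w = 0%N.
  rewrite /tree_lca_depth (lca_depth_ancestor (tparent0 t) (@ord0_ancestor t)) ?depth_root//.
  exact: ord0_ancestor.
rewrite attachment_meanE; congr (_ / _).
(* Going from u to its parent loses one for each w below u. The total loss is the path length Z, so
   the full sum Y + Z drops to Y. *)
have -> : \sum_(u : node t | u != ord0)
      ((\sum_(w : node t) tree_lca_depth (tparent u) w)%:R : R) =
    (Y t)%:R.
  rewrite -natr_sum; congr _%:R.
  apply/eqP; rewrite -(eqn_add2r (path_length t)) -sum_lca_depth; apply/eqP.
  rewrite [RHS](bigD1 ord0)//= [X in (_ = X + _)%N]big1 ?add0n//.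
  have -> : path_length t = (\sum_(u : node t | u != ord0) \sum_(w : node t)
      ancestor (@tparent t) u w)%N.
    rewrite exchange_big/=; apply: eq_bigr => w _.
    exact: depth_sum_ancestors (tparent0 t) (@ord0_ancestor t) w.
  rewrite -big_split/=; apply: eq_bigr => u u0; rewrite -big_split/=.
  by apply: eq_bigr => w _; rewrite -(lca_depth_parent (tparent0 t) (@ord0_ancestor t)).
rewrite -natr_sum sum_lca_depth natrD; ring.
Qed.

Lemma tree_depth_parent t (u : node t) : u != ord0 ->
  (tree_depth (tparent u)).+1 = tree_depth u.
Proof. by move=> u0; rewrite -(depth_parent (@ord0_ancestor t)). Qed.

Lemma tree_depth0 t : tree_depth (ord0 : node t) = 0%N.
Proof. exact: depth_root. Qed.

(** The new leaf lies one level below its parent, so this is the mean increment of the path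
    length. *)
Lemma attachment_mean_depth t :
  mean (fun v : node t => (tree_depth v).+1%:R) =
  ((path_length t)%:R + rho * n_ t) / (n_ t - a).
Proof.
rewrite attachment_meanE; congr (_ / _).
under [X in _ + a * X]eq_bigr do rewrite tree_depth_parent//.
rewrite (sum_nonroot (fun u : node t => (tree_depth u)%:R)) tree_depth0 subr0.
under eq_bigr do rewrite -natr1.
rewrite big_split/= sumr_const card_ord -/(node_count t) -natr_sum.
by rewrite -/(path_length t); ring.
Qed.

Lemma attachment_mean_gf (x : R) t :
  mean (fun v : node t => x ^+ (tree_depth v).+1) =
  ((rho * x + a) * depth_gf x t - a) / (n_ t - a).
Proof.
rewrite attachment_meanE; congr (_ / _).
under [X in _ + a * X]eq_bigr do rewrite tree_depth_parent//.
rewrite (sum_nonroot (fun u : node t => x ^+ (tree_depth u))) tree_depth0 expr0.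
under eq_bigr do rewrite exprS.
by rewrite -mulr_sumr -/(depth_gf x t); ring.
Qed.

(** * The martingale and the conditional variance of its steps *)

Definition Ymart t : R :=
  ((Y t)%:R + 2 * rho * (path_length t)%:R + 2 * rho ^+ 2 * n_ t - rho ^+ 2 * a)
  / ((n_ t - a) * (n_ t + 1 - a)).

Let Ymart_num t : R :=
  (Y t)%:R + 2 * rho * (path_length t)%:R + 2 * rho ^+ 2 * n_ t - rho ^+ 2 * a.

Let Ymart_incr t (v : node t) : R :=
  2 * (\sum_(w : node t) tree_lca_depth v w)%:R + 2 * rho * (tree_depth v).+1%:R
  + 2 * rho ^+ 2.

Let Ymart_add_child t (v : node t) :
  Ymart (add_child v) = (Ymart_num t + Ymart_incr v)
    / ((n_ t + 1 - a) * (n_ t + 2 - a)).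
Proof.
rewrite /Ymart /Ymart_num /Ymart_incr node_count_add_child Y_add_child.
rewrite path_length_add_child -natr1 natrD natrM (natrD _ (path_length t)).
congr (_ / _); ring.
Qed.

(** The coefficients are chosen so that the numerator N has mean increment 2 N / (n - a). It thus
    grows by the factor (n + 2 - a) / (n - a), as the denominator does. *)
Lemma attachment_mean_Ymart t : mean (fun v : node t => Ymart (add_child v)) = Ymart t.
Proof.
have -> : (fun v : node t => Ymart (add_child v)) =
    (fun v => ((n_ t + 1 - a) * (n_ t + 2 - a))^-1 *
       (Ymart_num t + (2 * (\sum_(w : node t) tree_lca_depth v w)%:R +
       (2 * rho * (tree_depth v).+1%:R + 2 * rho ^+ 2)))).
  by apply/funext => v; rewrite Ymart_add_child mulrC /Ymart_incr -!addrA.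
rewrite attachment_meanZ !(attachment_meanD, attachment_mean_cst, attachment_meanZ).
rewrite attachment_mean_lca attachment_mean_depth /Ymart_num /Ymart.
have := node_count_gt0 t; move: (n_ t) => n n0.
field.
by rewrite !gt_eqF//; lra.
Qed.

(** The cross term vanishes since F - mean F has mean 0. This serves both to bound a variance by the
    distance to any constant and to add up martingale increments. *)
Lemma attachment_mean_sqr_dist t (F : node t -> R) (c : R) :
  mean (fun v => (F v - c) ^+ 2) =
  mean (fun v => (F v - mean F) ^+ 2) + (mean F - c) ^+ 2.
Proof.
set m := mean F.
have -> : (fun v => (F v - c) ^+ 2) =
    (fun v => ((F v - m) ^+ 2 + ((2 * (m - c)) * F v + (c ^+ 2 - m ^+ 2)))).
  by apply/funext => v; ring.
rewrite !(attachment_meanD, attachment_mean_cst, attachment_meanZ) -/m; ring.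
Qed.

(* The solution x of (1 - a) x + a = 3 / 2; any right-hand side in ]1, 2[ would do. *)
Definition gf_base : R := 1 + (2 * rho)^-1.

(* The shift turns the affine recursion of the mean of [depth_gf] into a linear one. *)
Definition gf_mart t : R := depth_gf gf_base t - 2 / 3 * a.

Lemma gf_base_ge1 : 1 <= gf_base.
Proof. by rewrite lerDl invr_ge0 mulr_ge0// subr_ge0 ltW. Qed.

Lemma gf_mart_mean_pow t :
  mean (fun v : node t => gf_base ^+ (tree_depth v).+1) =
  3 / 2 * gf_mart t / (n_ t - a).
Proof.
rewrite attachment_mean_gf /gf_mart; congr (_ / _).
have -> : rho * gf_base = rho + 1 / 2.
  by rewrite /gf_base; field; rewrite gt_eqF// subr_gt0.
by field.
Qed.

Lemma attachment_mean_gf_mart t :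
  mean (fun v : node t => gf_mart (add_child v)) =
  gf_mart t * (1 + 3 / 2 / (n_ t - a)).
Proof.
have -> : (fun v : node t => gf_mart (add_child v)) =
    (fun v => gf_mart t + gf_base ^+ (tree_depth v).+1).
  by apply/funext => v; rewrite /gf_mart depth_gf_add_child addrAC.
by rewrite attachment_meanD attachment_mean_cst gf_mart_mean_pow; ring.
Qed.

Lemma depth_gf_ge1 t : 1 <= depth_gf gf_base t.
Proof.
rewrite /depth_gf (bigD1 ord0)//= tree_depth0 expr0 lerDl.
by apply: sumr_ge0 => v _; rewrite exprn_ge0// (le_trans ler01)// gf_base_ge1.
Qed.

(** Writing S for the left side, the claim amounts to a <= S, and S >= 1 > a. *)
Lemma depth_gf_le t : depth_gf gf_base t <= 3 * gf_mart t.
Proof.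
have := depth_gf_ge1 t; rewrite /gf_mart; move: (depth_gf _ _) => S S1.
by have := a_lt1; nra.
Qed.

Lemma gf_mart_ge0 t : 0 <= gf_mart t.
Proof. by have := depth_gf_ge1 t; have := depth_gf_le t; lra. Qed.

(** An exponential beats a square; this bounds squared depths by the generating function. *)
Lemma sqr_le_pow : exists2 B : R, 0 < B &
  forall k : nat, k.+1%:R ^+ 2 <= B * gf_base ^+ k.
Proof.
set e := (2 * rho)^-1; have e0 : 0 < e by rewrite invr_gt0 mulr_gt0// subr_gt0.
(* For w >= A one has 2 w + 1 <= 3 w <= e w^2, hence (w + 1)^2 <= (1 + e) w^2. The induction runs on
   the shifted square (k + 1 + A)^2 to stay in this range. *)
pose A := 1 + 3 / e.
have A1 : 1 <= A by rewrite lerDl divr_ge0// ltW.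
have eA : 3 <= e * A by rewrite /A mulrDr mulrCA divff ?gt_eqF//; lra.
exists ((1 + A) ^+ 2); first by rewrite exprn_gt0//; lra.
suff H (k : nat) : (k%:R + 1 + A) ^+ 2 <= (1 + A) ^+ 2 * gf_base ^+ k.
  move=> k; apply: le_trans (H k); rewrite ler_sqr ?nnegrE//.
  - by rewrite -natr1 lerDl; lra.
  - by have := ler0n R k; lra.
elim: k => [|k IH]; first by rewrite add0r expr0 mulr1.
rewrite [gf_base ^+ k.+1]exprSr mulrA; apply: le_trans (ler_wpM2r _ IH); last first.
  by rewrite (le_trans ler01)// gf_base_ge1.
rewrite /gf_base -/e -natr1; have := ler0n R k; move: (k%:R) => u u0.
set w := u + 1 + A; have wA : A <= w by rewrite /w; lra.
have -> : u + 1 + 1 + A = w + 1 by rewrite /w; ring.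
have we : 3 * w <= e * w ^+ 2.
  rewrite expr2 mulrA ler_wpM2r//; first lra.
  by apply: le_trans eA _; rewrite ler_wpM2l// ltW.
nra.
Qed.

Lemma path_length_le : exists2 B : R, 0 < B &
  forall t, (path_length t)%:R <= B * gf_mart t.
Proof.
have [B B0 HB] := sqr_le_pow; exists (B * 3) => [|t]; first by rewrite mulr_gt0.
rewrite -mulrA; apply: le_trans (_ : B * depth_gf gf_base t <= _); last first.
  by rewrite ler_wpM2l ?depth_gf_le// ltW.
rewrite natr_sum mulr_sumr; apply: ler_sum => v _; apply: le_trans (HB _).
rewrite -natr1; have := ler0n R (tree_depth v); nra.
Qed.

(** For a <= 0, n - a >= n; for a > 0, n >= 1 gives n - a >= (1 - a) n. *)
Lemma node_count_lower : exists2 q : R, 0 < q & forall t, q * n_ t <= n_ t - a.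
Proof.
exists (Num.min 1 rho); first by rewrite lt_min ltr01 subr_gt0.
move=> t; have := ler1n R (node_count t); rewrite [(0 < _)%N]isT => n1.
have : Num.min 1 rho <= 1 by rewrite ge_min lexx.
have : Num.min 1 rho <= rho by rewrite ge_min lexx orbT.
have := ler0n R (node_count t).
have [a0|a0] := leP 0 a; nra.
Qed.

(** The numerator moves by O(n (h + 1)) and the denominator is of order n^2. The mean of (h + 1)^2
    is at most a constant times the mean of x^(h+1), which is O([gf_mart] / n). *)
Lemma Ymart_var_le : exists2 C : R, 0 < C & forall t,
  (forall v : node t, 0 <= attachment_prob a rho v) ->
  mean (fun v : node t => (Ymart (add_child v) - Ymart t) ^+ 2) <=
  C * (gf_mart t / n_ t ^+ 3).
Proof.
have [B B0 HB] := sqr_le_pow; have [q q0 Hq] := node_count_lower.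
have rho0 : 0 < rho by rewrite subr_gt0.
pose c := 2 + 2 * rho + 2 * rho ^+ 2.
have c0 : 0 < c by rewrite /c; nra.
(* Four factors q come from the squared denominator of the martingale and one from n - a in
   [gf_mart_mean_pow], which also gives 3 / 2. *)
exists (c ^+ 2 * B * (3 / 2) / q ^+ 5).
  by rewrite divr_gt0 ?mulr_gt0 ?exprn_gt0//.
move=> t at0.
have n1 : 1 <= n_ t by rewrite ler1n.
have incr_ge0 (v : node t) : 0 <= Ymart_incr v.
  rewrite /Ymart_incr !addr_ge0 ?mulr_ge0 ?exprn_ge0 ?ler0n ?ltW//.
have incr_le (v : node t) : Ymart_incr v ^+ 2 <=
    c ^+ 2 * n_ t ^+ 2 * B * gf_base ^+ (tree_depth v).+1.
  apply: le_trans (_ : (c * n_ t * (tree_depth v).+1%:R) ^+ 2 <= _); last first.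
    rewrite !exprMn -(mulrA _ B); apply: ler_wpM2l.
      by rewrite mulr_ge0 ?sqr_ge0.
    apply: le_trans (HB _) _; rewrite ler_wpM2l ?(ltW B0)//.
    by rewrite ler_weXn2l ?gf_base_ge1.
  rewrite ler_sqr ?nnegrE ?incr_ge0 ?mulr_ge0 ?ler0n ?(ltW c0)//.
  have lca_le : (\sum_(w : node t) tree_lca_depth v w)%:R <= n_ t * (tree_depth v)%:R.
    rewrite -natrM ler_nat /node_count.
    rewrite -[in X in (_ <= X * _)%N](card_ord (size (parents t)).+1).
    rewrite -sum_nat_const; apply: leq_sum => w _.
    exact: lca_depth_lel (tparent0 t) (@ord0_ancestor t) v w.
  rewrite /Ymart_incr /c -[(tree_depth v).+1%:R]natr1; move: lca_le n1.
  move: (\sum_w _)%:R (n_ t) (tree_depth v)%:R (ler0n R (tree_depth v)) => s n h h0 sn n1.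
  have : 0 <= rho * ((n - 1) * (h + 1)) by rewrite !mulr_ge0//; lra.
  have : 0 <= rho ^+ 2 * (n * (h + 1) - 1) by rewrite mulr_ge0 ?sqr_ge0//; nra.
  by nra.
set k := ((n_ t + 1 - a) * (n_ t + 2 - a))^-1.
have mean_eq : mean (fun v : node t => Ymart (add_child v)) = Ymart t.
  exact: attachment_mean_Ymart.
(* The variance is at most the mean square distance to the part of the new value that does not
   depend on v. *)
have := attachment_mean_sqr_dist (fun v : node t => Ymart (add_child v)) (Ymart_num t * k).
rewrite mean_eq => E.
apply: le_trans (_ : mean (fun v : node t => (Ymart (add_child v) - Ymart_num t * k) ^+ 2) <= _).
  by rewrite E lerDl sqr_ge0.
apply: le_trans (_ : mean (fun v : node t =>
    k ^+ 2 * (c ^+ 2 * n_ t ^+ 2 * B) * gf_base ^+ (tree_depth v).+1) <= _).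
  apply: attachment_meanS => // v.
  rewrite Ymart_add_child -/k mulrDl addrAC subrr add0r exprMn mulrC -mulrA.
  by rewrite ler_wpM2l ?sqr_ge0 ?incr_le.
rewrite attachment_meanZ gf_mart_mean_pow.
have := Hq t; have := gf_mart_ge0 t; rewrite /k.
move: (gf_mart t) (n_ t) n1 => U n n1 U0 qn.
have n0 : 0 < n by lra.
have qn0 : 0 < q * n by rewrite mulr_gt0.
have -> : c ^+ 2 * B * (3 / 2) / q ^+ 5 * (U / n ^+ 3) =
    ((q * n) ^+ 2)^-1 ^+ 2 * (c ^+ 2 * n ^+ 2 * B) * (3 / 2 * U / (q * n)).
  by field; rewrite !gt_eqF.
have cB0 : 0 <= c ^+ 2 * n ^+ 2 * B 
  by rewrite mulr_ge0 ?(ltW B0)// mulr_ge0 ?sqr_ge0.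
have inv_le : ((n + 1 - a) * (n + 2 - a))^-1 <= ((q * n) ^+ 2)^-1.
  rewrite lef_pV2 ?posrE; [|nra|nra].
  rewrite expr2 ler_pM//; lra.
have inv_ge0 : 0 <= ((n + 1 - a) * (n + 2 - a))^-1 by rewrite invr_ge0; nra.
rewrite ler_pM//.
- by rewrite mulr_ge0 ?sqr_ge0.
- by rewrite divr_ge0 ?mulr_ge0//; lra.
- by rewrite ler_wpM2r// ler_sqr// nnegrE invr_ge0 sqr_ge0.
- by rewrite ler_wpM2l ?mulr_ge0// lef_pV2 ?posrE//; lra.
Qed.

End AttachmentMean.

(** * The law of the process *)

Section FiniteLaw.
Context {R : realType} {d : measure_display} {Omega : measurableType d}
  (P : probability Omega R) {I : countType} (X : Omega -> I) (r : seq I).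
Hypothesis mX : forall i, measurable [set x | X x = i].
Hypothesis r_uniq : uniq r.
Lemma measurable_countable_preimage (A : set I) : measurable (X @^-1` A).
Proof.
have -> : X @^-1` A = \bigcup_i (if i \in A then [set x | X x = i] else set0).
  apply/seteqP; split => [x Ax|x [i _]]; first by exists (X x); rewrite ?mem_set.
  by case: ifPn => //= /set_mem Ai ->.
apply: countable_bigcupT_measurable => [|i]; first exact: countableP.
by case: ifP.
Qed.

Lemma measurable_fun_countable (F : I -> R) : measurable_fun setT (F \o X).
Proof.
move=> _ Y mY; rewrite setTI -[_ @^-1` _]/(X @^-1` (F @^-1` Y)).
exact: measurable_countable_preimage.
Qed.

Lemma probability_mem_finite :
  P (X @^-1` [set` r]) = (\sum_(i <- r) P [set x | X x = i])%E.
Proof.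
have -> : X @^-1` [set` r] = \bigcup_(i in [set` r]) [set x | X x = i].
  by apply/seteqP; split => x /= => [Xr|[i ir ->]//]; exists (X x).
rewrite measure_fin_bigcup//; first by rewrite -fsbig_seq.
  exact: finite_seq.
by move=> i j _ _ [x [/= -> ->]].
Qed.

Lemma ae_mem_finiteP :
  (\sum_(i <- r) P [set x | X x = i] = 1)%E <-> {ae P, forall x, X x \in r}.
Proof.
have mXr : measurable (X @^-1` [set` r]) by exact: measurable_countable_preimage.
rewrite -probability_mem_finite; split=> [Xr1|Xr].
  exists (~` (X @^-1` [set` r])); split; last by [].
    exact: measurableC.
  by rewrite probability_setC// Xr1 subee.
have : P (~` (X @^-1` [set` r])) = 0%E by exact/measure_negligible/Xr/measurableC.
rewrite probability_setC// => /eqP; rewrite sube_eq// ?fin_num_measure//.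
by rewrite add0e => /eqP <-.
Qed.

Hypothesis r_full : {ae P, forall x, X x \in r}.

(** Off a null set, F o X is a finite combination of indicators of the level sets of [X]. *)
Lemma integral_finite_law (F : I -> R) :
  (\int[P]_x (F (X x))%:E =
   (\sum_(i <- r) fine (P [set x | X x = i]) * F i)%:E)%E.
Proof.
pose G x : R := \sum_(i <- r) F i * \1_[set x | X x = i] x.
have intG i : P.-integrable setT (fun x => (F i)%:E * (\1_[set x | X x = i] x)%:E)%E.
  by apply: integrableZl => //; apply: integrable_indic.
transitivity (\int[P]_x (\sum_(i <- r) (F i)%:E * (\1_[set x | X x = i] x)%:E))%E.
  apply: ae_eq_integral => //.
  - by exact/measurable_EFinP/measurable_fun_countable.
  - by apply: emeasurable_sum => i; apply: measurable_int (intG i).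
  apply: filterS r_full => x Xr _.
  rewrite (bigD1_seq (X x))//= big1 => [|i iX]; rewrite indicE.
    by rewrite mem_set// mule1 adde0.
  by rewrite memNset ?mule0// => /= E; rewrite E eqxx in iX.
rewrite integral_sum// -sumEFin; apply: eq_bigr => i _.
rewrite integralZl//; last exact: integrable_indic.
rewrite integral_indic// setIT muleC EFinM fineK//.
exact: fin_num_measure.
Qed.

End FiniteLaw.

(* Index shift: [trees n] lists the trees with n.+1 nodes, the possible values of
   T n.+1; likewise [tree_mean n] below is the mean under the law of T n.+1. *)
Fixpoint trees (n : nat) : seq growing_tree :=
  if n is n'.+1 then [seq add_child v | t <- trees n', v <- enum (node t)]
  else [:: single_root].

Lemma node_count_trees (n : nat) (t : growing_tree) :
  t \in trees n -> node_count t = n.+1.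
Proof.
elim: n t => [|n IH] t; first by rewrite inE => /eqP->.
by case/allpairsPdep => s [v [sn _ ->]]; rewrite node_count_add_child IH.
Qed.

Lemma parents_add_child (t : growing_tree) (v : node t) :
  parents (add_child v) = rcons (parents t) v.
Proof. by []. Qed.

Lemma add_child_inj (t t' : growing_tree) (v : node t) (v' : node t') :
  add_child v = add_child v' -> t = t' /\ v = v' :> nat.
Proof.
move=> /(congr1 parents); rewrite !parents_add_child => /rcons_inj[tt' vv'].
by split=> //; apply: val_inj.
Qed.

Lemma add_child_tagged_inj :
  injective (fun u : {t & node t} => add_child (tagged u)).
Proof.
move=> [t v] [t' v'] /= /add_child_inj[tt']; subst t' => /ord_inj.
by move=> ->.
Qed.

Lemma trees_uniq (n : nat) : uniq (trees n).
Proof.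
elim: n => // n IH; apply: allpairs_uniq_dep => // [t _|u u' _ _].
  exact: enum_uniq.
exact: add_child_tagged_inj.
Qed.

(** * Finite laws of the attachment process and the tower property *)

Section PreferentialAttachmentLaw.
Context {R : realType} {d : measure_display} {Omega : measurableType d}
  (P : probability Omega R) (a : R) (T : nat -> Omega -> growing_tree).
Hypothesis a_lt1 : a < 1.
Hypothesis T_pref : pref_attachment P a (1 - a) T.

Local Notation mean := (attachment_mean a (1 - a)).

(** The possible values of two consecutive trees; pairs are listed because [pa_step] gives a joint
    law. *)
Let step_trees n : seq (growing_tree * growing_tree) :=
  [seq (t, add_child v) | t <- trees n, v <- enum (node t)].

Let step_trees_uniq n : uniq (step_trees n).
Proof.
apply: allpairs_uniq_dep => // [|t _|u u' _ _ /(congr1 snd)].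
- exact: trees_uniq.
- exact: enum_uniq.
- exact: add_child_tagged_inj.
Qed.

Let mT n t : measurable [set x | T n.+1 x = t].
Proof. exact: (pa_measurable T_pref). Qed.

Let mTT n (u : growing_tree * growing_tree) :
  measurable [set x | (T n.+1 x, T n.+2 x) = u].
Proof.
case: u => t t'; rewrite (_ : [set x | _] =
  [set x | T n.+1 x = t] `&` [set x | T n.+2 x = t']); first exact: measurableI.
by apply/seteqP; split => x /= [-> ->].
Qed.

Let law_step n t (v : node t) :
  P [set x | (T n.+1 x, T n.+2 x) = (t, add_child v)] =
  (P [set x | T n.+1 x = t] * (attachment_prob a (1 - a) v)%:E)%E.
Proof.
rewrite -(pa_step T_pref)//; congr (P _).
by apply/seteqP; split => x /= [-> ->].
Qed.

Let sum_attachment_prob t : \sum_(v : node t) attachment_prob a (1 - a) v = 1.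
Proof.
rewrite -[RHS](attachment_mean_cst a_lt1 t 1).
by apply: eq_bigr => v _; rewrite mulr1.
Qed.

(** The masses of the listed pairs add up to 1, because the attachment probabilities from each tree
    do. *)
Let ae_step n : {ae P, forall x, T n.+1 x \in trees n} ->
  {ae P, forall x, (T n.+1 x, T n.+2 x) \in step_trees n}.
Proof.
move=> /(ae_mem_finiteP _ (mT n) (trees_uniq n)) full.
apply/(ae_mem_finiteP P (mTT n) (step_trees_uniq n)).
rewrite big_allpairs_dep -full; apply: eq_bigr => t _.
under eq_bigr do rewrite law_step.
rewrite big_enum/= -(@fineK _ (P _)) ?fin_num_measure//.
under eq_bigr do rewrite -EFinM.
by rewrite sumEFin -mulr_sumr sum_attachment_prob mulr1.
Qed.

Lemma ae_trees n : {ae P, forall x, T n.+1 x \in trees n}.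
Proof.
elim: n => [|n IH].
  apply/(ae_mem_finiteP P (mT 0) (trees_uniq 0)).
  by rewrite big_seq1 (pa_start T_pref).
apply: filterS (ae_step IH) => x /allpairsPdep[t [v [tn _ [_ ->]]]].
by apply/allpairsPdep; exists t, v; rewrite mem_enum.
Qed.

Lemma ae_growth : {ae P, forall x, T 1 x = single_root /\
  forall n, exists v : node (T n.+1 x), T n.+2 x = add_child v}.
Proof.
have : {ae P, forall x n, exists v : node (T n.+1 x), T n.+2 x = add_child v}.
  apply: ae_foralln => n; apply: filterS (ae_step (ae_trees n)) => x.
  by case/allpairsPdep => t [v [_ _ [-> ->]]]; exists v.
apply: filterS2 (ae_trees 0) => x; rewrite inE => /eqP T1 ?; split=> //.
Qed.

Definition tree_mean (n : nat) (F : growing_tree -> R) : R :=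
  \sum_(t <- trees n) fine (P [set x | T n.+1 x = t]) * F t.

Lemma integral_tree_mean n (F : growing_tree -> R) :
  (\int[P]_x (F (T n.+1 x))%:E = (tree_mean n F)%:E)%E.
Proof. exact: integral_finite_law (mT n) (trees_uniq n) (ae_trees n) F. Qed.

Lemma tree_mean0 (F : growing_tree -> R) : tree_mean 0 F = F single_root.
Proof. by rewrite /tree_mean big_seq1 (pa_start T_pref) mul1r. Qed.

(** The tower property, conditioning on the tree one step earlier. *)
Lemma tree_meanS n (F : growing_tree -> R) :
  tree_mean n.+1 F = tree_mean n (fun t => mean (fun v : node t => F (add_child v))).
Proof.
apply: EFin_inj; rewrite -integral_tree_mean.
have := integral_finite_law (mTT n) (step_trees_uniq n) (ae_step (ae_trees n))
  (fun u => F u.2) => /= ->; congr _%:E.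
rewrite big_allpairs_dep; apply: eq_bigr => t _.
rewrite big_enum/= mulr_sumr; apply: eq_bigr => v _.
by rewrite law_step fineM ?fin_num_measure//= -mulrA.
Qed.

(* For chi < 0 some trees have negative attachment probabilities, but [pa_step] shows
   that the process does not charge them. *)
Lemma tree_mean_le n (F G : growing_tree -> R) :
  (forall t, t \in trees n -> (forall v : node t, 0 <= attachment_prob a (1 - a) v) ->
    F t <= G t) -> tree_mean n F <= tree_mean n G.
Proof.
move=> FG; rewrite /tree_mean big_seq [leRHS]big_seq; apply: ler_sum => t tn.
have p0 : (0 <= P [set x | T n.+1 x = t])%E by [].
have [->|pN0] := eqVneq (fine (P [set x | T n.+1 x = t])) 0; first by rewrite !mul0r.
have p_gt0 : 0 < fine (P [set x | T n.+1 x = t]) by rewrite lt_neqAle eq_sym pN0 fine_ge0.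
apply: ler_wpM2l; first exact: ltW.
apply: FG => // v; rewrite -(pmulr_rge0 _ p_gt0) -lee_fin EFinM fineK ?fin_num_measure//.
by rewrite -law_step.
Qed.

Lemma tree_meanD n (F G : growing_tree -> R) :
  tree_mean n (fun t => F t + G t) = tree_mean n F + tree_mean n G.
Proof. by rewrite -big_split/=; apply: eq_bigr => t _; rewrite mulrDr. Qed.

Lemma tree_meanZ n (c : R) (F : growing_tree -> R) :
  tree_mean n (fun t => c * F t) = c * tree_mean n F.
Proof. by rewrite mulr_sumr; apply: eq_bigr => t _; rewrite mulrCA. Qed.

Lemma eq_tree_mean n (F G : growing_tree -> R) :
  {in trees n, F =1 G} -> tree_mean n F = tree_mean n G.
Proof.
by move=> FG; rewrite /tree_mean big_seq [RHS]big_seq; apply: eq_bigr => t /FG->.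
Qed.

End PreferentialAttachmentLaw.

(** * Second moments *)

Lemma is_growth_take (n : nat) (t : growing_tree) : is_growth (take n (parents t)).
Proof.
apply/allP => k; rewrite mem_iota add0n/= size_take_min leq_min => /andP[kn kt].
rewrite nth_take//; apply: (allP (parents_growth t)).
by rewrite mem_iota.
Qed.

(** The tree as it was after n attachments. It makes a martingale increment over several steps a
    function of the later tree alone, so [tree_mean] applies to it. *)
Definition subtree_at (n : nat) (t : growing_tree) : growing_tree :=
  GrowingTree (is_growth_take n t).

Lemma subtree_at_id (t : growing_tree) : subtree_at (size (parents t)) t = t.
Proof. by apply: val_inj; rewrite /= take_size. Qed.

Lemma subtree_at_add_child (n : nat) (t : growing_tree) (v : node t) :
  (n <= size (parents t))%N -> subtree_at n (add_child v) = subtree_at n t.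
Proof. by move=> le_n; apply: val_inj; rewrite /= -cats1 takel_cat. Qed.

Section SecondMoment.
Context {R : realType} {d : measure_display} {Omega : measurableType d}
  (P : probability Omega R) (a : R) (T : nat -> Omega -> growing_tree).
Hypothesis a_lt1 : a < 1.
Hypothesis T_pref : pref_attachment P a (1 - a) T.

Local Notation mean := (attachment_mean a (1 - a)).
Local Notation E := (tree_mean P T).

Lemma size_parents_trees (n : nat) (t : growing_tree) :
  t \in trees n -> size (parents t) = n.
Proof. by move=> /node_count_trees[]. Qed.

Lemma growth_subtree_at (x : Omega) :
  T 1 x = single_root ->
  (forall n, exists v : node (T n.+1 x), T n.+2 x = add_child v) ->
  forall n m, (n <= m)%N ->
  size (parents (T m.+1 x)) = m /\ T n.+1 x = subtree_at n (T m.+1 x).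
Proof.
move=> T1 TS.
have sz m : size (parents (T m.+1 x)) = m.
  elim: m => [|m IH]; first by rewrite T1.
  by have [v ->] := TS m; rewrite size_rcons IH.
have self n : T n.+1 x = subtree_at n (T n.+1 x).
  by rewrite -[X in subtree_at X _](sz n) subtree_at_id.
move=> n; elim=> [|m IH]; first by rewrite leqn0 => /eqP->.
rewrite leq_eqVlt => /orP[/eqP->//|].
rewrite ltnS => nm; split=> //; have [_ ->] := IH nm.
by have [v ->] := TS m; rewrite subtree_at_add_child ?sz.
Qed.

Lemma tree_mean_gf_mart n :
  E n.+1 (gf_mart a) = E n (gf_mart a) * (1 + 3 / 2 / (n.+1%:R - a)).
Proof.
rewrite (tree_meanS a_lt1 T_pref) mulrC -tree_meanZ; apply: eq_tree_mean => t tn.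
by rewrite (attachment_mean_gf_mart a_lt1) (node_count_trees tn) mulrC.
Qed.

Lemma tree_mean_gf_mart_ge0 n : 0 <= E n (gf_mart a).
Proof.
apply: le_trans (_ : E n (fun=> 0) <= _).
  by rewrite /tree_mean big1// => t _; rewrite mulr0.
by apply: (tree_mean_le T_pref) => t _ _; apply: gf_mart_ge0.
Qed.

(** Growth of order n^(3/2), squared to avoid fractional powers. With m = n + 1 - a, the recursion
    closes since m^3 (1 + 3 / (2 m))^2 = m^3 + 3 m^2 + 9 m / 4 <= (m + 1)^3. *)
Lemma tree_mean_gf_mart_le : exists2 C : R, 0 < C &
  forall n, E n (gf_mart a) ^+ 2 <= C * n.+1%:R ^+ 3.
Proof.
pose c := E 0 (gf_mart a) ^+ 2 / (1 - a) ^+ 3.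
have c0 : 0 <= c by rewrite divr_ge0 ?sqr_ge0// exprn_ge0// subr_ge0 ltW.
have le_c n : E n (gf_mart a) ^+ 2 <= c * (n.+1%:R - a) ^+ 3.
  elim: n => [|n IH].
    by rewrite /c divfK// expf_neq0// gt_eqF// subr_gt0.
  rewrite tree_mean_gf_mart exprMn -(natr1 n.+1).
  have : 0 < n.+1%:R - a by rewrite subr_gt0 (lt_le_trans a_lt1)// ler1n.
  have -> : n.+1%:R + 1 - a = n.+1%:R - a + 1 by rewrite addrAC.
  move: (n.+1%:R - a) IH => m IH m0.
  apply: le_trans (ler_wpM2r (sqr_ge0 _) IH) _.
  rewrite -(mulrA c); apply: ler_wpM2l => //.
  have -> : m ^+ 3 * (1 + 3 / 2 / m) ^+ 2 = m ^+ 3 + 3 * m ^+ 2 + 9 / 4 * m.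
    by field; rewrite gt_eqF.
  have -> : (m + 1) ^+ 3 = m ^+ 3 + 3 * m ^+ 2 + 3 * m + 1 by ring.
  lra.
(* n + 1 - a <= (1 + |a|) (n + 1), and c + 1 is positive even if c = 0. *)
exists ((c + 1) * (1 + `|a|) ^+ 3); first by rewrite mulr_gt0 ?exprn_gt0//; have := normr_ge0 a; lra.
move=> n; apply: le_trans (le_c n) _; rewrite -(mulrA (c + 1)) -exprMn.
have n1 : 1 <= n.+1%:R :> R by rewrite ler1n.
have an0 : 0 <= n.+1%:R - a by have := a_lt1; lra.
apply: ler_pM => //; [exact: exprn_ge0|lra|].
apply: lerXn2r; rewrite ?nnegrE//.
have := normr_ge0 a; have := ler_norm (- a); rewrite normrN.
move: (`|a|) (n.+1%:R) n1 {an0} => b m m1; nra.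
Qed.

(** Orthogonality of martingale increments: each further step adds only its conditional variance. *)
Lemma tree_mean_sqr_dist : exists2 C : R, 0 < C & forall n m, (n <= m)%N ->
  E m (fun t => (Ymart a t - Ymart a (subtree_at n t)) ^+ 2) <=
  \sum_(n <= j < m) C * (E j (gf_mart a) / j.+1%:R ^+ 3).
Proof.
have [C C0 HC] := Ymart_var_le a_lt1; exists C => // n.
have self m : E m (fun t => (Ymart a t - Ymart a (subtree_at m t)) ^+ 2) = 0.
  rewrite /tree_mean big_seq big1// => t tm.
  by rewrite -[X in subtree_at X _](size_parents_trees tm) subtree_at_id
    subrr expr0n mulr0.
elim=> [|m IH]; first by rewrite leqn0 => /eqP->; rewrite self big_geq.
rewrite leq_eqVlt => /orP[/eqP->|]; first by rewrite self big_geq.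
rewrite ltnS => nm; rewrite big_nat_recr//=; apply: le_trans (lerD (IH nm) (lexx _)).
rewrite (tree_meanS a_lt1 T_pref) mulrA mulrAC -tree_meanZ -tree_meanD.
apply: (tree_mean_le T_pref) => t tm t0.
have -> : (fun v : node t =>
    (Ymart a (add_child v) - Ymart a (subtree_at n (add_child v))) ^+ 2) =
    (fun v => (Ymart a (add_child v) - Ymart a (subtree_at n t)) ^+ 2).
  by apply/funext => v; rewrite subtree_at_add_child// (size_parents_trees tm).
rewrite attachment_mean_sqr_dist// attachment_mean_Ymart// addrC lerD2l.
by apply: le_trans (HC t t0) _; rewrite (node_count_trees tm) mulrAC mulrA.
Qed.

(** The predecessor undoes the index shift: the tree in question has (k + 1)^6 nodes. *)
Definition sparse_time (k : nat) : nat := (k.+1 ^ 6).-1.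

Lemma sparse_timeS k : (sparse_time k).+1 = (k.+1 ^ 6)%N.
Proof. by rewrite prednK// expn_gt0. Qed.

(** With K = k + 1, a block has O(K^5) steps, each of variance O(K^(-9)). For the path length, n
    times O(n^(-3/2)) / n gives O(K^(-3)) at n = K^6, relaxed to K^(-2). *)
Lemma tree_mean_sparse : exists2 C : R, 0 < C & forall k,
  E (sparse_time k.+1) (fun t =>
    (Ymart a t - Ymart a (subtree_at (sparse_time k) t)) ^+ 2) <= C / k.+1%:R ^+ 4 /\
  E (sparse_time k) (fun t => (path_length t)%:R / (node_count t)%:R ^+ 2)
    <= C / k.+1%:R ^+ 2.
Proof.
have [C C0 HC] := tree_mean_sqr_dist; have [B B0 HB] := path_length_le a_lt1.
have [D D0 HD] := tree_mean_gf_mart_le.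
have gf_le (k : nat) (j : nat) : (k.+1 ^ 6 <= j.+1)%N ->
    E j (gf_mart a) / j.+1%:R ^+ 3 <= (D + 1) / k.+1%:R ^+ 9.
  move=> kj; have : k.+1%:R ^+ 6 <= j.+1%:R :> R by rewrite -natrX ler_nat.
  have := HD j; have := tree_mean_gf_mart_ge0 j.
  have : 0 < k.+1%:R :> R by [].
  move: (E j _) (j.+1%:R) (k.+1%:R) => p m K K0 p0 pm Km.
  have K6 : 0 < K ^+ 6 by rewrite exprn_gt0.
  have m0 : 0 < m by apply: lt_le_trans Km.
  (* The growth bound concerns the square, so squares are compared; D <= (D + 1)^2 avoids a square
     root of D. *)
  rewrite -ler_sqr ?nnegrE; last 2 first.
  - by rewrite divr_ge0// exprn_ge0// ltW.
  - by rewrite divr_ge0 ?exprn_ge0 ?(ltW K0)//; lra.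
  rewrite !expr_div_n ler_pdivrMr ?exprn_gt0//; apply: le_trans pm _.
  have -> : (D + 1) ^+ 2 / (K ^+ 9) ^+ 2 * (m ^+ 3) ^+ 2 =
      (D + 1) ^+ 2 * m ^+ 3 * (m ^+ 3 / (K ^+ 6) ^+ 3).
    by field; rewrite gt_eqF.
  have : 1 <= m ^+ 3 / (K ^+ 6) ^+ 3.
    by rewrite ler_pdivlMr ?exprn_gt0// mul1r lerXn2r// nnegrE ltW.
  have : 0 < m ^+ 3 by rewrite exprn_gt0.
  move: (m ^+ 3) (m ^+ 3 / _) => u w u0 w1.
  apply: le_trans (_ : (D + 1) ^+ 2 * u <= _).
    by rewrite ler_wpM2r ?(ltW u0)//; nra.
  by rewrite ler_peMr// mulr_ge0 ?sqr_ge0 ?ltW.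
exists (63 * C * (D + 1) + B * (D + 1)).
  by rewrite addr_gt0 ?mulr_gt0//; lra.
move=> k; split.
  have le_k : (sparse_time k <= sparse_time k.+1)%N.
    by rewrite -ltnS !sparse_timeS leq_exp2r.
  apply: le_trans (HC _ _ le_k) _.
  apply: le_trans (_ : \sum_(sparse_time k <= j < sparse_time k.+1)
      C * ((D + 1) / k.+1%:R ^+ 9) <= _).
    rewrite big_nat [leRHS]big_nat; apply: ler_sum => j /andP[kj _].
    by rewrite ler_wpM2l ?(ltW C0)// gf_le// -sparse_timeS ltnS.
  rewrite sumr_const_nat -[X in X <= _]mulr_natl.
  have -> : (sparse_time k.+1 - sparse_time k = k.+2 ^ 6 - k.+1 ^ 6)%N.
    by rewrite -!sparse_timeS subSS.
  (* 63 = 6 + 15 + 20 + 15 + 6 + 1 sums the coefficients of (K + 1)^6 - K^6, each power being at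
     most K^5. *)
  apply: le_trans (_ : (63 * k.+1%:R ^+ 5) * (C * ((D + 1) / k.+1%:R ^+ 9)) <= _).
    rewrite ler_wpM2r//.
      by rewrite mulr_ge0 ?divr_ge0 ?exprn_ge0 ?ltW//; lra.
    rewrite natrB ?leq_exp2r// !natrX -(natr1 k.+1).
    have : 1 <= k.+1%:R :> R by rewrite ler1n.
    move: (k.+1%:R) => K K1.
    have -> : (K + 1) ^+ 6 - K ^+ 6 =
      6 * K ^+ 5 + 15 * K ^+ 4 + 20 * K ^+ 3 + 15 * K ^+ 2 + 6 * K + 1 by ring.
    have pw i j : (i <= j)%N -> K ^+ i <= K ^+ j by move=> ?; apply: ler_weXn2l.
    have := pw 4 5 isT; have := pw 3 5 isT; have := pw 2 5 isT.
    have := pw 1%N 5 isT; have := pw 0%N 5 isT; rewrite expr0 expr1; lra.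
  have K0 : 0 < k.+1%:R :> R by [].
  move: (k.+1%:R) K0 => K K0.
  have -> : 63 * K ^+ 5 * (C * ((D + 1) / K ^+ 9)) = 63 * C * (D + 1) / K ^+ 4.
    by field; rewrite gt_eqF.
  rewrite ler_wpM2r ?invr_ge0 ?exprn_ge0 ?(ltW K0)// lerDl mulr_ge0 ?ltW//; lra.
apply: le_trans (_ : B * ((sparse_time k).+1%:R *
    (E (sparse_time k) (gf_mart a) / (sparse_time k).+1%:R ^+ 3)) <= _).
  have -> : (sparse_time k).+1%:R * (E (sparse_time k) (gf_mart a) / (sparse_time k).+1%:R ^+ 3)
      = (sparse_time k).+1%:R ^- 2 * E (sparse_time k) (gf_mart a).
    by field.
  rewrite mulrA -tree_meanZ; apply: (tree_mean_le T_pref) => t tk _.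
  by rewrite (node_count_trees tk) mulrAC ler_wpM2r ?HB//.
apply: le_trans (_ : B * ((sparse_time k).+1%:R * ((D + 1) / k.+1%:R ^+ 9)) <= _).
  by rewrite !ler_wpM2l ?(ltW B0)// gf_le// sparse_timeS.
rewrite sparse_timeS natrX; have : 1 <= k.+1%:R :> R by rewrite ler1n.
move: (k.+1%:R) => K K1; have K0 : 0 < K by lra.
have -> : B * (K ^+ 6 * ((D + 1) / K ^+ 9)) = B * (D + 1) / K ^+ 3.
  by field; rewrite gt_eqF.
rewrite ler_pM ?invr_ge0 ?exprn_ge0 ?mulr_ge0 ?(ltW B0) ?(ltW K0)//; [lra| |].
  by rewrite lerDr !mulr_ge0 ?(ltW C0)//; lra.
by rewrite lef_pV2 ?posrE ?exprn_gt0// ler_weXn2l.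
Qed.

End SecondMoment.

(** * Almost sure convergence *)

(** The telescoping series of [u] converges absolutely by comparison with [h]. The uniform bound
    will supply a dominating function. *)
Lemma cvg_of_summable_increments {R : realType} (u h : R^nat) (b : R) :
  (forall k, `|u k.+1 - u k| <= h k) ->
  (forall n, \sum_(k < n) h k <= b) ->
  cvgn u /\ forall n, `|u n| <= `|u 0%N| + b.
Proof.
move=> uh hb.
have h0 k : 0 <= h k by apply: le_trans (uh k).
split.
  have cvg_h : cvgn (series h).
    apply: nondecreasing_is_cvgn.
      by apply/nondecreasing_seqP => n; rewrite seriesSr lerDl h0.
    by exists b => _ [n _ <-]; rewrite /series/= big_mkord hb.
  have cvg_tel : cvgn (series (telescope u)).
    by apply: normed_cvg; apply: series_le_cvg cvg_h => n; [exact: normr_ge0| |exact: uh].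
  have -> : u = (fun n => u 0%N) + series (telescope u).
    by apply/funext => n; rewrite eq_sum_telescope.
  by apply: is_cvgD => //; exact: is_cvg_cst.
move=> n; apply: le_trans (_ : `|u 0%N| + \sum_(k < n) h k <= _).
  elim: n => [|n IH]; first by rewrite big_ord0 addr0.
  rewrite big_ord_recr/= addrA -[u n.+1](subrK (u n)) [_ - _ + _]addrC.
  exact: le_trans (ler_normD _ _) (lerD IH (uh n)).
by rewrite lerD2l.
Qed.

Section DominatedIncrements.
Context {R : realType} {d : measure_display} {Omega : measurableType d}
  (P : probability Omega R).

(** The sum G of the [h k] is integrable, hence almost surely finite. Where it is, [M] converges and
    [h] vanishes, and |c| + G dominates [M], so means pass to the limit. *)
Lemma ae_cvg_dominated_increments (M h : nat -> Omega -> R) (c b : R) :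
  (forall k, measurable_fun setT (M k)) ->
  (forall k, measurable_fun setT (h k)) ->
  (forall k x, 0 <= h k x) ->
  {ae P, forall x, M 0 x = c} ->
  {ae P, forall x k, `|M k.+1 x - M k x| <= h k x} ->
  (\sum_(k <oo) \int[P]_x (h k x)%:E <= b%:E)%E ->
  exists Q : {RV P >-> R},
    [/\ {ae P, forall x, M ^~ x @ \oo --> Q x},
        {ae P, forall x, h ^~ x @ \oo --> 0} &
        (fun k => \int[P]_x (M k x)%:E)%E @ \oo --> 'E_P[Q]%E].
Proof.
move=> mM mh h0 M0 Mh hb.
pose G x := (\sum_(k <oo) (h k x)%:E)%E.
have mG : measurable_fun setT G.
  apply: ge0_emeasurable_sum => [k x _ _|k _]; first by rewrite lee_fin.
  exact/measurable_EFinP.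
have G0 x : (0 <= G x)%E by apply: nneseries_ge0 => k _ _; rewrite lee_fin.
have iG : P.-integrable setT G.
  apply/integrableP; split=> //.
  under eq_integral do rewrite gee0_abs//.
  rewrite integral_nneseries//; last by move=> k x _; rewrite lee_fin.
    by apply: le_lt_trans hb _; rewrite ltry.
  by move=> k; exact/measurable_EFinP.
have finG := integrable_ae measurableT iG.
have sum_le x : G x \is a fin_num -> forall n, \sum_(k < n) h k x <= fine (G x).
  move=> Gx n; rewrite -lee_fin fineK// -sumEFin -(big_mkord xpredT (fun k => (h k x)%:E)).
  by apply: nneseries_lim_ge => k _; rewrite lee_fin.
have good : {ae P, forall x, cvgn (M ^~ x) /\ (forall n, `|M n x| <= `|c| + fine (G x)) /\
    h ^~ x @ \oo --> 0 /\ G x \is a fin_num}.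
  near=> x.
  have Gx : G x \is a fin_num by near: x; apply: filterS finG => x; apply.
  have Mx : forall k, `|M k.+1 x - M k x| <= h k x by near: x.
  have [cvgM leM] := cvg_of_summable_increments Mx (sum_le x Gx).
  split=> //; split; first by have <- : M 0 x = c by near: x.
  split=> //; apply: cvg_series_cvg_0.
  apply: nondecreasing_is_cvgn.
    by apply/nondecreasing_seqP => n; rewrite seriesSr lerDl h0.
  by exists (fine (G x)) => _ [n _ <-]; rewrite /series/= big_mkord sum_le.
(* The upper limit is defined and measurable everywhere and equals the limit wherever [M]
   converges. *)
pose q x := fine (limn_esup (fun k => (M k x)%:E)).
have mq : measurable_fun setT q.
  apply: measurableT_comp; first exact: fine_measurable.
  by apply: measurable_fun_limn_esup => k; exact/measurable_EFinP.
pose Q : {RV P >-> R} := HB.pack q (isMeasurableFun.Build _ _ Omega R q mq).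
have MQ : {ae P, forall x, M ^~ x @ \oo --> Q x}.
  apply: filterS good => x [cvgM _].
  have cM : (fun k => (M k x)%:E) @ \oo --> (limn (M ^~ x))%:E.
    by apply: cvg_EFin => //; exact: nearW.
  rewrite /Q /= /q is_cvg_limn_esupE; last by apply/cvg_ex; exists (limn (M ^~ x))%:E.
  by rewrite (cvg_lim _ cM).
exists Q; split => //; first by apply: filterS good => x [_ [_ []]].
rewrite expectation_def.
have [] := @dominated_convergence _ _ _ P setT measurableT
  (fun k x => (M k x)%:E) (EFin \o Q) (fun x => `|c|%:E + G x)%E.
- by move=> k; exact/measurable_EFinP.
- by apply/measurable_EFinP.
- apply: filterS MQ => x + _; apply: cvg_EFin; exact: nearW.
- apply: integrableD => //; exact: finite_measure_integrable_cst.
- apply: filterS good => x [_ [leM [_ Gx]]] n _.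
  by rewrite -(fineK Gx) -EFinD abse_EFin lee_fin.
by [].
Unshelve. all: by end_near.
Qed.

End DominatedIncrements.

(** * Interpolation between sparse times *)

Lemma sparse_time_bracket (n : nat) :
  exists k, (sparse_time k <= n < sparse_time k.+1)%N.
Proof.
elim: n => [|n [k /andP[kn nk]]]; first by exists 0%N.
have [lt_n|ge_n] := ltnP n.+1 (sparse_time k.+1).
  by exists k; rewrite (leqW kn).
exists k.+1; have -> : n.+1 = sparse_time k.+1 by apply/eqP; rewrite eqn_leq nk.
by rewrite leqnn/= -ltnS !sparse_timeS ltn_exp2r.
Qed.

(* Along [sparse_time] consecutive indices have ratio tending to 1, so monotonicity
   controls the sequence in between. *)
Lemma cvg_sparse_time {R : realType} (y : R^nat) (q : R) :
  (forall n, y n <= y n.+1) -> (forall n, 0 <= y n) ->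
  (fun k => y (sparse_time k) / (sparse_time k).+1%:R ^+ 2) @ \oo --> q ->
  (fun n => y n / n.+1%:R ^+ 2) @ \oo --> q.
Proof.
move=> y_mono y0 yq.
have y_le : nondecreasing_seq y by apply/nondecreasing_seqP.
pose s k : R := (sparse_time k).+1%:R.
have s0 k : 0 < s k by rewrite ltr0n.
have s_ratio : (fun k => s k.+1 / s k) @ \oo --> (1 : R).
  have -> : (fun k => s k.+1 / s k) = (fun u : R => u ^+ 6) \o (fun k => 1 + harmonic k).
    apply/funext => k /=; rewrite /s /harmonic !sparse_timeS !natrX -expr_div_n.
    by rewrite -[k.+2%:R]natr1 mulrDl divff ?pnatr_eq0// mul1r.
  rewrite -[X in _ --> X](expr1n _ 6).
  apply: continuous_cvg; first exact: exprn_continuous.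
  rewrite -[X in _ --> X]addr0.
  exact: cvgD (@cvg_cst _ _ _ _ _) cvg_harmonic.
have [kap kapP] := choice sparse_time_bracket.
have kap_oo : kap @ \oo --> \oo.
  apply/cvgnyPge => m; near=> n.
  rewrite leqNgt; apply/negP => lt_m.
  have /andP[_] := kapP n; rewrite ltnNge => /negP; apply.
  apply: leq_trans (_ : sparse_time m <= n)%N.
    by rewrite -ltnS !sparse_timeS leq_exp2r.
  by near: n; exact: nbhs_infty_ge.
(* These are y(s_k) / s_(k+1)^2 and y(s_(k+1)) / s_k^2, written as a convergent sequence times a
   power of a ratio tending to 1. *)
pose lo k := y (sparse_time k) / s k ^+ 2 / (s k.+1 / s k) ^+ 2.
pose up k := y (sparse_time k.+1) / s k.+1 ^+ 2 * (s k.+1 / s k) ^+ 2.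
have s_ratio2 : (fun k => (s k.+1 / s k) ^+ 2) @ \oo --> (1 : R).
  rewrite -[X in _ --> X]mulr1; exact: (cvgM s_ratio s_ratio).
have lo_q : lo @ \oo --> q.
  rewrite -[q]mulr1 -[X in _ * X]invr1; apply: cvgM => //.
  by apply: cvgV => //; exact: oner_neq0.
have up_q : up @ \oo --> q.
  rewrite -[q]mulr1; apply: cvgM => //.
  by rewrite (cvg_shiftS (fun k => y (sparse_time k) / s k ^+ 2)).
apply: (@squeeze_cvgr _ _ _ _ (lo \o kap) (up \o kap)).
- near=> n; have /andP[kn nk] := kapP n; rewrite /lo /up /=; set k := kap n in kn nk *.
  have sn : s k <= n.+1%:R by rewrite ler_nat ltnS.
  have ns : n.+1%:R <= s k.+1 by rewrite ler_nat ltnW.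
  have n0 : 0 < n.+1%:R :> R by [].
  apply/andP; split.
    have -> : y (sparse_time k) / s k ^+ 2 / (s k.+1 / s k) ^+ 2 =
        y (sparse_time k) / s k.+1 ^+ 2 by field; rewrite !gt_eqF.
    apply: ler_pM; rewrite ?invr_ge0 ?exprn_ge0 ?(ltW (s0 _))//; first exact: y_le.
    by rewrite lef_pV2 ?posrE ?exprn_gt0// lerXn2r// nnegrE ltW.
  have -> : y (sparse_time k.+1) / s k.+1 ^+ 2 * (s k.+1 / s k) ^+ 2 =
      y (sparse_time k.+1) / s k ^+ 2 by field; rewrite !gt_eqF.
  apply: ler_pM; rewrite ?invr_ge0 ?exprn_ge0 ?(ltW n0)//; first exact/y_le/ltnW.
  by rewrite lef_pV2 ?posrE ?exprn_gt0// lerXn2r// nnegrE ltW.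
- exact: cvg_comp kap_oo lo_q.
- exact: cvg_comp kap_oo up_q.
Unshelve. all: by end_near.
Qed.

Lemma sum_inv_sqr_le {R : realType} (n : nat) :
  \sum_(0 <= k < n) (k.+1%:R ^- 2 : R) <= 2.
Proof.
(* The sharper bound telescopes: 1 / m^2 <= 2 / m - 2 / (m + 1) for m >= 1. *)
suff : \sum_(0 <= k < n) (k.+1%:R ^- 2 : R) <= 2 - 2 / n.+1%:R.
  by move=> /le_trans; apply; rewrite gerBl divr_ge0.
elim: n => [|n IH]; first by rewrite big_geq// divr1 subrr.
rewrite big_nat_recr//=; apply: le_trans (lerD IH (lexx _)) _.
rewrite -[n.+2%:R]natr1; have : 1 <= n.+1%:R :> R by rewrite ler1n.
move: (n.+1%:R) => m m1; have m0 : 0 < m by lra.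
rewrite -subr_ge0.
have -> : 2 - 2 / (m + 1) - (2 - 2 / m + m ^- 2) = (m - 1) / (m ^+ 2 * (m + 1)).
  by field; rewrite !gt_eqF//; lra.
rewrite divr_ge0 ?mulr_ge0 ?sqr_ge0//; lra.
Qed.

(** * Convergence for weights with chi + rho = 1 *)

Section NormalizedAttachment.
Context {R : realType} {d : measure_display} {Omega : measurableType d}
  (P : probability Omega R) (a : R) (T : nat -> Omega -> growing_tree).
Hypothesis a_lt1 : a < 1.
Hypothesis T_pref : pref_attachment P a (1 - a) T.

Local Notation E := (tree_mean P T).

Lemma tree_mean_Ymart n : E n (Ymart a) = 1 - a.
Proof.
elim: n => [|n IH].
  rewrite (tree_mean0 T_pref) /Ymart Y_single_root path_length_single_root.
  by rewrite /node_count/=; field; rewrite !gt_eqF//; have := a_lt1; lra.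
rewrite (tree_meanS a_lt1 T_pref) -[RHS]IH; apply: eq_tree_mean => t _.
exact: attachment_mean_Ymart.
Qed.

Lemma tree_mean_cst n (c : R) : E n (fun=> c) = c.
Proof.
apply: EFin_inj; rewrite -(integral_tree_mean a_lt1 T_pref) integral_cst//.
by rewrite [X in (_ * X)%E](probability_setT P) mule1.
Qed.

Lemma measurable_fun_tree n (F : growing_tree -> R) :
  measurable_fun setT (fun x => F (T n.+1 x)).
Proof.
exact: (@measurable_fun_countable _ _ _ _ _ (fun t => pa_measurable T_pref t (ltn0Sn n))).
Qed.

Let Ym k x : R := Ymart a (T (sparse_time k).+1 x).

(* [step_bound k] is (K^2 D^2 + K^-2) / 2 >= |D| with K = k.+1 and D the increment of
   [Ym], so that second moments control first moments. *)
Let step_bound k x : R :=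
  let t := T (sparse_time k.+1).+1 x in
  (k.+1%:R ^+ 2 * (Ymart a t - Ymart a (subtree_at (sparse_time k) t)) ^+ 2
   + k.+1%:R ^- 2) / 2.

(** Added to [step_bound], so that the same summability argument makes Z / n^2 vanish along the
    sparse times. *)
Let depth_bound k x : R :=
  let t := T (sparse_time k).+1 x in (path_length t)%:R / (node_count t)%:R ^+ 2.

Let step_bound_ge0 k x : 0 <= step_bound k x.
Proof.
by apply: divr_ge0 => //; apply: addr_ge0; rewrite ?invr_ge0 ?sqr_ge0// mulr_ge0 ?sqr_ge0.
Qed.

Let depth_bound_ge0 k x : 0 <= depth_bound k x.
Proof. by rewrite divr_ge0 ?sqr_ge0. Qed.

Let m_step_bound k : measurable_fun setT (step_bound k).
Proof.
exact: (measurable_fun_tree (sparse_time k.+1) (fun t =>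
  (k.+1%:R ^+ 2 * (Ymart a t - Ymart a (subtree_at (sparse_time k) t)) ^+ 2
   + k.+1%:R ^- 2) / 2)).
Qed.

Let m_depth_bound k : measurable_fun setT (depth_bound k).
Proof.
exact: (measurable_fun_tree (sparse_time k) (fun t =>
  (path_length t)%:R / (node_count t)%:R ^+ 2)).
Qed.

Let integral_bounds : exists b : R,
  (\sum_(k <oo) \int[P]_x (step_bound k x + depth_bound k x)%:E <= b%:E)%E.
Proof.
have [C C0 HC] := tree_mean_sparse a_lt1 T_pref.
(* The k-th integral is at most (C / 2 + 1 / 2 + C) K^(-2) with K = k + 1, and the K^(-2) sum to at
   most 2. *)
exists ((2 * C + 1) * 2).
apply: le_trans (_ : \sum_(k <oo) ((2 * C + 1) * k.+1%:R ^- 2)%:E <= _)%E.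
  apply: lee_nneseries => [k _ _|k _].
    by apply: integral_ge0 => x _; rewrite lee_fin addr_ge0.
  under eq_integral do rewrite EFinD.
  rewrite ge0_integralD//; last 4 first.
  - by move=> x _; rewrite lee_fin.
  - exact/measurable_EFinP.
  - by move=> x _; rewrite lee_fin.
  - exact/measurable_EFinP.
  have [] := HC k.
  rewrite (integral_tree_mean a_lt1 T_pref (sparse_time k.+1) (fun t =>
    (k.+1%:R ^+ 2 * (Ymart a t - Ymart a (subtree_at (sparse_time k) t)) ^+ 2
    + k.+1%:R ^- 2) / 2)).
  rewrite (integral_tree_mean a_lt1 T_pref (sparse_time k) (fun t =>
    (path_length t)%:R / (node_count t)%:R ^+ 2)).
  have -> : (fun t => (k.+1%:R ^+ 2 *
      (Ymart a t - Ymart a (subtree_at (sparse_time k) t)) ^+ 2 + k.+1%:R ^- 2) / 2) =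
      (fun t => (k.+1%:R ^+ 2 / 2) *
      (Ymart a t - Ymart a (subtree_at (sparse_time k) t)) ^+ 2 + k.+1%:R ^- 2 / 2).
    by apply/funext => t; rewrite mulrDl mulrAC.
  rewrite tree_meanD tree_meanZ tree_mean_cst -EFinD lee_fin.
  have : 0 < k.+1%:R :> R by [].
  move: (E _ _) (E _ _) (k.+1%:R) => q p K K0 pK qK.
  have : K ^+ 2 / 2 * p <= C / 2 * K ^- 2.
    have -> : C / 2 * K ^- 2 = K ^+ 2 / 2 * (C / K ^+ 4) by field; rewrite gt_eqF.
    by rewrite ler_wpM2l// divr_ge0 ?sqr_ge0.
  have : 0 < C * K ^- 2 by rewrite mulr_gt0// invr_gt0 exprn_gt0.
  have : 0 < K ^- 2 by rewrite invr_gt0 exprn_gt0.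
  by move: (K ^- 2) qK => w qK w0 Cw0 pw; lra.
apply: lime_le.
  apply: is_cvg_nneseries => k _ _; rewrite lee_fin mulr_ge0 ?invr_ge0 ?sqr_ge0//; lra.
apply: nearW => n; rewrite sumEFin lee_fin -mulr_sumr ler_wpM2l ?sum_inv_sqr_le//.
lra.
Qed.

Let ae_step_bound : {ae P, forall x k, `|Ym k.+1 x - Ym k x| <= step_bound k x}.
Proof.
apply: filterS (ae_growth a_lt1 T_pref) => x [T1 TS] k.
have le_k : (sparse_time k <= sparse_time k.+1)%N.
  by rewrite -ltnS !sparse_timeS leq_exp2r.
rewrite /Ym /step_bound -(growth_subtree_at T1 TS le_k).2.
set D := (_ - _); rewrite -[D ^+ 2]real_normK ?num_real//.
have : 0 < k.+1%:R :> R by [].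
move: (`|D|) (k.+1%:R) => e K K0.
rewrite ler_pdivlMr// -subr_ge0.
have -> : K ^+ 2 * e ^+ 2 + K ^- 2 - e * 2 = (K * e - K^-1) ^+ 2.
  by field; rewrite gt_eqF.
exact: sqr_ge0.
Qed.

Let Y_sqr_cvg (x : Omega) (q : R) :
  T 1 x = single_root ->
  (forall n, exists v : node (T n.+1 x), T n.+2 x = add_child v) ->
  (fun k => Ym k x) @ \oo --> q ->
  (fun k => step_bound k x + depth_bound k x) @ \oo --> (0 : R) ->
  (fun n => (Y (T n x))%:R / n%:R ^+ 2 : R) @ \oo --> q.
Proof.
move=> T1 TS Yq h0.
(* The shift discards the irrelevant [T 0]. *)
rewrite -(cvg_shiftS (fun n => (Y (T n x))%:R / n%:R ^+ 2 : R)).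
apply: (@cvg_sparse_time _ (fun n => (Y (T n.+1 x))%:R)) => [n|n|].
- by have [v ->] := TS n; rewrite ler_nat Y_add_child leq_addr.
- exact: ler0n.
have z0 : (fun k => depth_bound k x) @ \oo --> (0 : R).
  apply: squeeze_cvgr h0; last exact: cvg_cst.
  by apply: nearW => k; rewrite depth_bound_ge0 lerDr step_bound_ge0.
pose w k : R := harmonic k ^+ 6.
have w0 : w @ \oo --> (0 : R).
  have := @continuous_cvg _ R R _ _ (@harmonic R) (fun u : R => u ^+ 6) 0
    (@exprn_continuous _ 6 _) cvg_harmonic.
  by rewrite expr0n => H; exact: H.
(* The definition of [Ymart] solved for Y / n^2, with w = 1 / n; all corrections tend to 0. *)
have -> : (fun k => (Y (T (sparse_time k).+1 x))%:R / (sparse_time k).+1%:R ^+ 2) =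
    (fun k => Ym k x * ((1 - a * w k) * (1 + (1 - a) * w k))
      - 2 * (1 - a) * depth_bound k x - 2 * (1 - a) ^+ 2 * w k
      + (1 - a) ^+ 2 * a * (w k * w k)).
  apply/funext => k.
  have nk : node_count (T (sparse_time k).+1 x) = (sparse_time k).+1.
    by rewrite /node_count (growth_subtree_at T1 TS (leqnn (sparse_time k))).1.
  rewrite /Ym /depth_bound /Ymart nk.
  have -> : w k = (sparse_time k).+1%:R^-1.
    by rewrite /w /harmonic sparse_timeS natrX exprVn.
  have : 1 <= (sparse_time k).+1%:R :> R by rewrite ler1n.
  move: (sparse_time k).+1%:R => m m1; have := a_lt1 => a1.
  by field; rewrite !gt_eqF//; lra.
have -> : q = q * ((1 - a * 0) * (1 + (1 - a) * 0)) - 2 * (1 - a) * 0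
    - 2 * (1 - a) ^+ 2 * 0 + (1 - a) ^+ 2 * a * (0 * 0) by ring.
have cstM (c l : R) (u : R^nat) : u @ \oo --> l -> (fun k => c * u k) @ \oo --> c * l.
  by move=> ul; apply: cvgM => //; exact: cvg_cst.
apply: cvgD; last by apply: cstM; apply: cvgM.
apply: cvgB; last exact: cstM.
apply: cvgB; last exact: cstM.
apply: cvgM => //; apply: cvgM.
  by apply: cvgB; [exact: cvg_cst|exact: cstM].
by apply: cvgD; [exact: cvg_cst|exact: cstM].
Qed.

Lemma Y_sqr_ae_cvg : exists Q : {RV P >-> R},
  {ae P, forall x, (fun n => (Y (T n x))%:R / n%:R ^+ 2 : R) @ \oo --> Q x} /\
  ('E_P[Q] = (1 - a)%:E)%E.
Proof.
have [b hb] := integral_bounds.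
have Ym0 : {ae P, forall x, Ym 0 x = Ymart a single_root}.
  by apply: filterS (ae_growth a_lt1 T_pref) => x [T1 _]; rewrite /Ym -T1.
have [||||Q [YmQ h0 EQ]] := @ae_cvg_dominated_increments _ _ _ P Ym
  (fun k x => step_bound k x + depth_bound k x) (Ymart a single_root) b _ _ _ Ym0 _ hb.
- by move=> k; exact: (measurable_fun_tree (sparse_time k) (Ymart a)).
- by move=> k; apply: measurable_funD.
- by move=> k x; rewrite addr_ge0.
- by apply: filterS ae_step_bound => x le_step k; rewrite (le_trans (le_step k))// lerDl.
exists Q; split.
  apply: filterS3 (ae_growth a_lt1 T_pref) YmQ h0 => x [T1 TS] Yq h0.
  exact: Y_sqr_cvg T1 TS Yq h0.
(* The means converge to the mean of [Q] and are constantly 1 - a. *)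
apply/esym/(cvg_unique _ _ EQ) => //.
rewrite (_ : (fun k => _) = cst (1 - a)%:E); first exact: cvg_cst.
apply/funext => k.
by rewrite (integral_tree_mean a_lt1 T_pref (sparse_time k) (Ymart a)) tree_mean_Ymart.
Qed.

End NormalizedAttachment.

Theorem corollary5p2 (R : realType) (d : measure_display)
    (Omega : measurableType d) (P : probability Omega R) (chi rho : R)
    (rho_gt0 : 0 < rho)
    (chi_rho : 0 <= chi \/
       (chi < 0 /\ exists m : nat, (0 < m)%N /\ rho / `|chi| = m%:R))
    (chiDrho_gt0 : 0 < chi + rho)
    (T : nat -> Omega -> growing_tree)
    (T_pref : pref_attachment P chi rho T) :
  exists Q : {RV P >-> R},
    {ae P, forall x, (fun n => (Y (T n x))%:R / n%:R ^+ 2 : R) @ \oo --> Q x} /\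
    ('E_P[Q] = (rho / (chi + rho))%:E)%E.
Proof.
(* Dividing the weights by chi + rho leaves the process unchanged; positivity of rho becomes a <
   1. *)
pose a := chi / (chi + rho).
have c0 : chi + rho != 0 by rewrite gt_eqF.
have rhoE : 1 - a = rho / (chi + rho) by rewrite /a; field.
have a_lt1 : a < 1 by rewrite -subr_gt0 rhoE divr_gt0.
rewrite -rhoE; apply: Y_sqr_ae_cvg => //.
split=> [n t n0||n t v n0]; first exact: (pa_measurable T_pref).
  exact: (pa_start T_pref).
rewrite (pa_step T_pref)// -(attachment_prob_scale a (1 - a) v c0) rhoE /a.
by rewrite ![_ * (_ / _)]mulrC !divfK.
Qed.
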